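(* The following statement (I) implies the following statement (II). (I) For every finite non-empty set $N$ of players with strategy spaces $\mathbb{R}^{n_\nu}$, $\nu\in N$, and $\mathbb{R}^n=\prod_{\nu\in N}\mathbb{R}^{n_\nu}$: if for each $\nu\in N$ the set $K_\nu\subset\mathbb{R}^{n_\nu}$ is compact, convex and non-empty, and $\theta_\nu:\mathbb{R}^n\to\mathbb{R}$ is continuous and quasi-convex with respect to its player's variable, then the set $\mathrm{NEP}(\{\theta_\nu,K_\nu\}_{\nu\in N})$ is non-empty. (II) For every finite non-empty set $N$ of players with strategy spaces $\mathbb{R}^{n_\nu}$, $\nu\in N$, and $\mathbb{R}^n=\prod_{\nu\in N}\mathbb{R}^{n_\nu}$: if $X$ is a convex, compact and non-empty subset of $\mathbb{R}^n$ and, for each $\nu\in N$, $\theta_\nu:\mathbb{R}^n\to\mathbb{R}$ is continuous and convex with respect to its player's variable, then the set $\mathrm{RGNEP}(\{\theta_\nu,X\}_{\nu\in N})$ is non-empty.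
   Context: For $x\in\mathbb{R}^n=\prod_{\nu\in N}\mathbb{R}^{n_\nu}$, write $x=(x^\nu,x^{-\nu})$, where $x^\nu\in\mathbb{R}^{n_\nu}$ is the component of player $\nu$ and $x^{-\nu}$ collects the components of the other players. A function $\theta_\nu$ is (quasi-)convex with respect to its player's variable if $\theta_\nu(\cdot,x^{-\nu}):\mathbb{R}^{n_\nu}\to\mathbb{R}$ is (quasi-)convex for every $x^{-\nu}$; a function $f$ is quasi-convex if $f(tx+(1-t)y)\le\max\{f(x),f(y)\}$ for all $x,y$ and $t\in[0,1]$. $\mathrm{NEP}(\{\theta_\nu,K_\nu\}_{\nu\in N})$ is the set of Nash equilibria: all $\hat x\in\prod_{\nu\in N}K_\nu$ such that $\theta_\nu(\hat x)\le\theta_\nu(x^\nu,\hat x^{-\nu})$ for all $\nu\in N$ and all $x^\nu\in K_\nu$. $\mathrm{RGNEP}(\{\theta_\nu,X\}_{\nu\in N})$ is the set of generalized Nash equilibria of Rosen's game: all $\hat x\in X$ such that for every $\nu\in N$ and every $x^\nu\in\mathbb{R}^{n_\nu}$ with $(x^\nu,\hat x^{-\nu})\in X$ one has $\theta_\nu(\hat x)\le\theta_\nu(x^\nu,\hat x^{-\nu})$. *)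

(* Defs.v *)
From HB Require Import structures.
From mathcomp Require Import all_boot all_order all_algebra.
From mathcomp Require Import all_classical all_reals all_analysis.

Set Implicit Arguments.
Unset Strict Implicit.
Unset Printing Implicit Defensive.

Import Order.TTheory GRing.Theory Num.Theory.
Import numFieldNormedType.Exports.
Local Open Scope classical_set_scope.
Local Open Scope ring_scope.
Local Open Scope convex_scope.

Definition profile (R : realType) (N : finType) (n : N -> nat) : Type :=
  prod_topology (fun v : N => 'rV[R]_(n v)).

(* The library has the product topology on dependent functions, but linear
   structures only on non-dependent ones. *)
Section ProfileLmodule.
Context {R : realType} {N : finType} (n : N -> nat).
Implicit Types (x y z : profile R n) (a b : R).

Let zero : profile R n := fun=> 0.
Let opp x : profile R n := fun v => - x v.
Let add x y : profile R n := fun v => x v + y v.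
Let scale a x : profile R n := fun v => a *: x v.

Let addA : associative add.
Proof. by move=> x y z; apply: functional_extensionality_dep => v; exact: addrA. Qed.
Let addC : commutative add.
Proof. by move=> x y; apply: functional_extensionality_dep => v; exact: addrC. Qed.
Let add0 : left_id zero add.
Proof. by move=> x; apply: functional_extensionality_dep => v; exact: add0r. Qed.
Let addN : left_inverse zero opp add.
Proof. by move=> x; apply: functional_extensionality_dep => v; exact: addNr. Qed.
Let scaleA a b x : scale a (scale b x) = scale (a * b) x.
Proof. by apply: functional_extensionality_dep => v; exact: scalerA. Qed.
Let scale1 : left_id 1 scale.
Proof. by move=> x; apply: functional_extensionality_dep => v; exact: scale1r. Qed.
Let scaleDr : right_distributive scale add.
Proof. by move=> a x y; apply: functional_extensionality_dep => v; exact: scalerDr. Qed.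
Let scaleDl x : {morph scale^~ x : a b / a + b >-> add a b}.
Proof. by move=> a b; apply: functional_extensionality_dep => v; exact: scalerDl. Qed.

HB.instance Definition _ := Uniform.on (profile R n).
HB.instance Definition _ :=
  GRing.isZmodule.Build (profile R n) addA addC add0 addN.
HB.instance Definition _ :=
  GRing.Zmodule_isLmodule.Build R (profile R n) scaleA scale1 scaleDr scaleDl.

End ProfileLmodule.

Definition quasiconvex_function (R : realType) (E : lmodType R)
    (f : convex_lmodType E -> R) : Prop :=
  forall (t : {i01 R}) x y, f (x <| t |> y) <= Num.max (f x) (f y).

Section Games.
Context {R : realType} {N : finType} {n : N -> nat}.
Implicit Types (v : N) (x : profile R n) (theta : N -> profile R n -> R).

(* (y, x^{-v}): the profile x with its v-th component replaced by y. *)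
Definition deviate x v (y : 'rV[R]_(n v)) : profile R n := dfwith x v y.

Definition player_convex v (f : profile R n -> R) : Prop :=
  forall x, convex_function setT (fun y : 'rV[R]_(n v) => f (deviate x y)).

Definition player_quasiconvex v (f : profile R n -> R) : Prop :=
  forall x, quasiconvex_function (fun y : 'rV[R]_(n v) => f (deviate x y)).

Definition NEP theta (K : forall v, set 'rV[R]_(n v)) : set (profile R n) :=
  [set x | (forall v, K v (x v)) /\
    forall v (y : 'rV[R]_(n v)), K v y -> theta v x <= theta v (deviate x y)].

Definition RGNEP theta (X : set (profile R n)) : set (profile R n) :=
  [set x | X x /\
    forall v (y : 'rV[R]_(n v)),
      X (deviate x y) -> theta v x <= theta v (deviate x y)].

End Games.

(* Main.v *)
Require Import Defs.
From HB Require Import structures.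
From mathcomp Require Import all_boot all_order all_algebra.
From mathcomp Require Import all_classical all_reals all_analysis.

Set Implicit Arguments.
Unset Strict Implicit.
Unset Printing Implicit Defensive.

Import Order.TTheory GRing.Theory Num.Theory.
Import numFieldNormedType.Exports.
Local Open Scope classical_set_scope.
Local Open Scope ring_scope.

(** Rosen's game is reduced to a game with only two players, whatever the
    original number of players.  Let
      Psi x y = sum over v of theta_v (y_v, x_{-v})
    be the Nikaido-Isoda function; it is continuous, and convex in y because
    each theta_v is convex in its own variable.  (This is where convexity
    rather than quasi-convexity is used: a sum of quasi-convex functions need
    not be quasi-convex.)  If x in X minimizes Psi x over X, then comparing x
    with the profiles of X that differ from x in the v-th component only, all
    terms but the v-th cancel, and x is a generalized equilibrium
    ([nikaido_isoda_min_RGNEP]).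

    Such a fixed point of the argmin correspondence is supplied by a Nash
    equilibrium of the following game.  Both players have the strategy set X;
    the first chooses x and pays |x - y|, the second chooses y and pays
    Psi x y.  At an equilibrium the first player copies the second, so x = y,
    and then optimality of the second player says that x minimizes Psi x.

    The set X lives in a product of spaces R^(n_v), whereas a single player
    plays in one R^M.  Coordinates are therefore listed in a single row
    ([flatten_profile]), a linear homeomorphism which preserves convexity and
    compactness of X and continuity and convexity of Psi. *)

Section ProductContinuity.
Context {T : topologicalType} {I : eqType} {K : I -> topologicalType}.

Lemma continuous_prod_topology (f : T -> prod_topology K) :
  (forall i, continuous (fun t => f t i)) -> continuous f.
Proof.
move=> cf t; apply/cvg_sup => i A [_ [[B oB <-] Bft] BA].
by apply: filterS BA _; apply: (cf i t B); exact: open_nbhs_nbhs.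
Qed.

End ProductContinuity.

Lemma continuous_matrix (T : topologicalType) (U : topologicalType) m k
    (f : T -> 'M[U]_(m, k)) :
  (forall i j, continuous (fun t => f t i j)) -> continuous f.
Proof.
move=> cf t A [P Pf PA]; apply: filterS PA _ => /=.
have FF : Filter (nbhs t) by exact: nbhs_filter.
(* A matrix has finitely many entries, so the entrywise neighbourhoods can be
   intersected. *)
suff : \forall s \near t, forall i j, P i j (f s i j) by [].
by apply: filter_forall => i; apply: filter_forall => j; exact: cf (Pf i j).
Qed.

Lemma continuous_component (R : realType) (N : finType) (n : N -> nat)
    (T : topologicalType) (f : T -> profile R n) v :
  continuous f -> continuous (fun t => f t v).
Proof.
move=> cf t; apply: (@continuous_comp _ _ _ f (proj v)); first exact: cf.
exact: proj_continuous.
Qed.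

Section Flatten.
Context {R : realType} {N : finType} (n : N -> nat).
Implicit Types x y : profile R n.

Let coordinate := {v : N & 'I_(n v)}.

Definition flatten_profile x : 'rV[R]_#|{: coordinate}| :=
  \row_i x (tag (enum_val i)) 0 (tagged (enum_val i)).

Definition unflatten_profile (r : 'rV[R]_#|{: coordinate}|) : profile R n :=
  fun v => \row_j r 0 (enum_rank (Tagged (fun v => 'I_(n v)) j)).

Lemma flatten_profileK : cancel flatten_profile unflatten_profile.
Proof.
move=> x; apply: functional_extensionality_dep => v.
by apply/rowP => j; rewrite !mxE enum_rankK.
Qed.

Lemma flatten_profile_lin a b x y :
  flatten_profile (a *: x + b *: y) =
  a *: flatten_profile x + b *: flatten_profile y.
Proof. by apply/rowP => i; rewrite !mxE. Qed.

Lemma unflatten_profile_lin a b r s :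
  unflatten_profile (a *: r + b *: s) =
  a *: unflatten_profile r + b *: unflatten_profile s.
Proof.
apply: functional_extensionality_dep => v.
by apply/rowP => i; rewrite !mxE.
Qed.

Lemma continuous_flatten_profile : continuous flatten_profile.
Proof.
apply: continuous_matrix => i j.
rewrite (_ : (fun _ => _) = fun x : profile R n =>
  x (tag (enum_val j)) 0 (tagged (enum_val j))); last first.
  by apply/funext => x; rewrite mxE.
move=> x; apply: (@continuous_comp (profile R n) _ _
  (fun x => x (tag (enum_val j)))
  (fun r : 'rV[R]_(n (tag (enum_val j))) => r 0 (tagged (enum_val j)))).
  by apply: (@continuous_component _ _ _ _ id) => y; exact: cvg_id.
exact: coord_continuous.
Qed.

Lemma continuous_unflatten_profile : continuous unflatten_profile.
Proof.
apply: continuous_prod_topology => v; apply: continuous_matrix => i j.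
rewrite (_ : (fun _ => _) = fun r : 'rV[R]_#|{: coordinate}| =>
  r 0 (enum_rank (Tagged (fun v => 'I_(n v)) j))); last first.
  by apply/funext => r; rewrite mxE.
exact: coord_continuous.
Qed.

End Flatten.

Lemma quasiconvex_of_convex (R : realType) (E : lmodType R) (f : E -> R) :
  (forall (t : {i01 R}) x y, f (t%:num *: x + (1 - t%:num) *: y) <=
     t%:num * f x + (1 - t%:num) * f y) ->
  quasiconvex_function f.
Proof.
move=> cf t x y; apply: le_trans (cf t x y) _.
have /andP[t0 t1] : 0 <= t%:num <= 1 by rewrite ge0 le1.
rewrite -[leRHS]mul1r -[X in X * Num.max _ _](subrKC t%:num 1) [leRHS]mulrDl.
by rewrite lerD// ler_wpM2l ?subr_ge0// le_max lexx ?orbT.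
Qed.

Section NikaidoIsoda.
Context {R : realType} {N : finType} {n : N -> nat}.
Variable theta : N -> profile R n -> R.
Implicit Types x y : profile R n.

Definition nikaido_isoda x y : R := \sum_v theta v (deviate x (y v)).

Lemma deviate_id x v : deviate x (x v) = x.
Proof.
apply: functional_extensionality_dep => w; rewrite /deviate.
by case: dfwithP.
Qed.

(** Against a profile of X that differs from x only in the v-th component, the
    terms of player v alone differ on the two sides, so the global
    minimization splits into the equilibrium condition of each player. *)
Lemma nikaido_isoda_min_RGNEP (X : set (profile R n)) x :
  X x -> (forall y, X y -> nikaido_isoda x x <= nikaido_isoda x y) ->
  RGNEP theta X x.
Proof.
move=> Xx xmin; split => // v y /xmin.
rewrite /nikaido_isoda (bigD1 v)//= [leRHS](bigD1 v)//=.
rewrite deviate_id {3}/deviate dfwithin.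
set s := \sum_(_ | _) _; set s' := \sum_(_ | _) _.
suff -> : s' = s by rewrite lerD2r.
apply: eq_bigr => w wv; congr (theta w (deviate x _)).
by rewrite /deviate dfwithout// eq_sym.
Qed.

Lemma nikaido_isoda_convex x y z (t : {i01 R}) :
  (forall v, player_convex v (theta v)) ->
  nikaido_isoda x (t%:num *: y + (1 - t%:num) *: z) <=
  t%:num * nikaido_isoda x y + (1 - t%:num) * nikaido_isoda x z.
Proof.
move=> cvx; rewrite /nikaido_isoda !mulr_sumr -big_split/=.
apply: ler_sum => v _.
by apply: (cvx v x t (y v) (z v)); rewrite inE.
Qed.

(** Joint continuity in both arguments is expressed by letting them depend on a
    common parameter t, which is the form needed when both are components of
    one strategy profile. *)
Lemma continuous_nikaido_isoda (T : topologicalType) (f g : T -> profile R n) :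
  (forall v, continuous (theta v)) -> continuous f -> continuous g ->
  continuous (fun t => nikaido_isoda (f t) (g t)).
Proof.
move=> ctheta cf cg; apply: continuous_big => [|v _ t].
  exact: add_continuous.
apply: (@continuous_comp _ _ _ (fun t => deviate (f t) (g t v)) (theta v));
  last exact: ctheta.
apply: continuous_prod_topology => w s; rewrite /deviate.
have [<-|vw] := eqVneq v w.
  rewrite (_ : (fun _ => _) = fun u => g u v); last first.
    by apply/funext => u; rewrite dfwithin.
  exact: continuous_component.
rewrite (_ : (fun _ => _) = fun u => f u w); last first.
  by apply/funext => u; rewrite dfwithout.
exact: continuous_component.
Qed.

End NikaidoIsoda.

Theorem theorem3p8 (R : realType) :
  (forall (N : finType) (n : N -> nat)
      (K : forall v : N, set 'rV[R]_(n v)) (theta : N -> profile R n -> R),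
    (0 < #|N|)%N ->
    (forall v, compact (K v)) ->
    (forall v, convex_set (K v)) ->
    (forall v, K v !=set0) ->
    (forall v, continuous (theta v)) ->
    (forall v, player_quasiconvex v (theta v)) ->
    NEP theta K !=set0) ->
  (forall (N : finType) (n : N -> nat)
      (X : set (profile R n)) (theta : N -> profile R n -> R),
    (0 < #|N|)%N ->
    convex_set X ->
    compact X ->
    X !=set0 ->
    (forall v, continuous (theta v)) ->
    (forall v, player_convex v (theta v)) ->
    RGNEP theta X !=set0).
Proof.
move=> nash N n X theta _ Xconvex Xcompact [x0 Xx0] ctheta cvx.
pose M := #|{: {v : N & 'I_(n v)}}|.
pose dim (_ : bool) := M.
pose K (_ : bool) : set 'rV[R]_M := @flatten_profile R N n @` X.
(* Player true imitates, player false minimizes the Nikaido-Isoda function at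
   the point chosen by player true. *)
pose cost (b : bool) (p : profile R dim) : R :=
  if b then `|p true - p false|
  else nikaido_isoda theta (unflatten_profile (p true))
                           (unflatten_profile (p false)).
have [p [pK pmin]] : NEP (n := dim) cost K !=set0.
  apply: nash.
  - by rewrite card_bool.
  - move=> b; apply: continuous_compact Xcompact.
    exact/continuous_subspaceT/continuous_flatten_profile.
  - move=> b r s t /set_mem[x Xx <-] /set_mem[y Xy <-]; apply/mem_set.
    exists (t%:num *: x + (1 - t%:num) *: y); last exact: flatten_profile_lin.
    by apply/set_mem/Xconvex; exact/mem_set.
  - by move=> b; exists (flatten_profile x0); exists x0.
  - have component_continuous b :
        continuous (fun p : profile R dim => p b : 'rV[R]_M).
      by apply: (@continuous_component _ _ _ _ id) => p; exact: cvg_id.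
    case=> /= p.
      apply: continuous_comp; last exact: norm_continuous.
      by apply: continuousB; exact: component_continuous.
    have proj_unflatten b :
        continuous (fun p : profile R dim => unflatten_profile (p b)).
      move=> q; apply: (@continuous_comp _ _ _ (fun p : profile R dim => p b)).
        exact: component_continuous.
      exact: continuous_unflatten_profile.
    exact: continuous_nikaido_isoda.
  - case=> q; apply: quasiconvex_of_convex => t y z; rewrite /cost /deviate.
      rewrite !dfwithin !dfwithout//.
      (* The weights add up to 1, so y - q and z - q combine like y and z. *)
      rewrite [in leLHS](_ : _ - _ = t%:num *: (y - q false) +
          (1 - t%:num) *: (z - q false)); last first.
        by rewrite !scalerBr addrACA -opprD -scalerDl subrKC scale1r.
      apply: le_trans (ler_normD _ _) _; rewrite !normrZ.
      by rewrite ger0_norm// ger0_norm// subr_ge0.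
    rewrite !dfwithin !dfwithout// unflatten_profile_lin.
    exact: nikaido_isoda_convex.
(* Copying the opponent is allowed, as both strategy sets are the same, and
   costs 0. *)
have eqp : p true = p false.
  apply/eqP; rewrite -subr_eq0 -normr_le0.
  have := pmin true (p false) (pK false).
  by rewrite /cost /deviate dfwithin dfwithout// subrr normr0.
have [x Xx xp] := pK false.
exists x; apply: nikaido_isoda_min_RGNEP => // y Xy.
have := pmin false (flatten_profile y).
rewrite /cost /deviate !dfwithin !dfwithout// eqp -xp !flatten_profileK; apply.
by exists y.
Qed.
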